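(* Let $n\ge 3$, let $\lambda=(n-2,1,1)\vdash n$, and let $X=X_1\cup X_2$ be the union of two distinct conjugacy classes of $S_n$, with $x_1\in X_1$, $x_2\in X_2$. Then $rS_n=XS_\lambda$ for some positive integer $r$ if and only if, for some labelling $\{i,j\}=\{1,2\}$, the element $x_i$ has no fixed points, $x_j$ has exactly $2$ fixed points, $|X_i|=|X_j|$, and $a_2+b_2=1$, where $a_2$ is the number of $2$-cycles of $x_i$ and $b_2$ is the number of $2$-cycles of $x_j$.
   Context: For a partition $\lambda=(\lambda_1,\dots,\lambda_l)$ of $n$, the Young subgroup $S_\lambda=S_{\lambda_1}\times\dots\times S_{\lambda_l}\le S_n$ is the subgroup preserving each of the consecutive blocks of $\{1,\dots,n\}$ of sizes $\lambda_1,\dots,\lambda_l$. For a finite group $G$, subsets $A,B\subseteq G$ and a positive integer $r$, the notation $rG=AB$ (also written $A\cdot B=rG$) means that for every $g\in G$ there are exactly $r$ pairs $(a,b)\in A\times B$ with $ab=g$. *)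

(* Defs.v *)
From HB Require Import structures.
From mathcomp Require Import all_boot all_fingroup.

Set Implicit Arguments.
Unset Strict Implicit.
Unset Printing Implicit Defensive.

(* r G = A B, where G is the whole group gT.  Products in 'S_n compose from left
   to right; for A closed under conjugation and B a subgroup, as below, the
   opposite convention gives the same notion, because (a, b) |-> (b^-1 a b, b)
   maps the pairs with a b = g bijectively onto the pairs with b a = g. *)
Definition mult_factorization (gT : finGroupType) (r : nat)
    (A B : {set gT}) : Prop :=
  forall g : gT,
    #|[set ab : gT * gT | [&& ab.1 \in A, ab.2 \in B
                            & (ab.1 * ab.2)%g == g]]| = r.

(* For la with sumn la = n, reshape_index la k is the position in la of the
   consecutive block of {0, ..., n - 1} that contains k. *)
Definition Young_subgroup (n : nat) (la : seq nat) : {set 'S_n} :=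
  [set s : 'S_n | [forall i : 'I_n,
     reshape_index la (s i) == reshape_index la i]].

Definition num_fixed_points (n : nat) (s : 'S_n) : nat :=
  #|[set i : 'I_n | s i == i]|.

Definition num_cycles (n : nat) (k : nat) (s : 'S_n) : nat :=
  #|[set c in porbits s | #|c| == k]|.

(* Main.v *)
Require Import Defs.
From HB Require Import structures.
From mathcomp Require Import all_boot all_fingroup.
From mathcomp Require Import zify.

Set Implicit Arguments.
Unset Strict Implicit.
Unset Printing Implicit Defensive.

(** The group S_lambda is the pointwise stabilizer of the last two points p and
    q, so a coset of it consists of the permutations with a prescribed
    behaviour at the preimages of p and q.  Hence r S_n = X S_lambda says that
    X is evenly spread over the transitions between ordered pairs of distinct
    points: for a suitable r, exactly r elements of X send (u, v) to (p, q),
    for all u <> v ([mult_factorization_Young]; other targets are reached by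
    conjugation, under which X is closed).

    Such an X satisfies three averaging identities, obtained by counting the
    elements of X that fix a point, fix a pair, or exchange a pair.  If f(x) is
    the number of fixed points and t(x) the number of 2-cycles of x, then
      sum_X f = sum_X f (f - 1) = sum_X 2 t = #|X|        ([uniform_moments]).
    The identities are also sufficient ([moments_uniform]).  The number of x
    sending (u, v) to (p, q) depends only on the coincidences among u, v, p and
    q, because X is closed under conjugation.  The second and third identities
    give the values for (u, v) -> (u, v) and (u, v) -> (v, u); the first one
    gives the number of x sending u to p, which is the sum over q of the
    numbers for (u, v) -> (p, q).  In each such sum all the terms that are not
    yet known are equal, so they can be found one type after another
    ([pair_count_extend]).

    When X is the union of two classes, of sizes m1 and m2, the identities
    become m1 f1 + m2 f2 = m1 f1 (f1 - 1) + m2 f2 (f2 - 1) = 2 m1 t1 + 2 m2 t2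
    = m1 + m2.  The mean of f is 1 while some fi (fi - 1) is nonzero, so one of
    f1, f2 vanishes; for the other one, f (f - 1) = f gives f = 2, then
    m1 = m2, and the last identity is t1 + t2 = 1 ([two_class_moments]). *)

Section Counting.

Variable T : finType.
Implicit Types (x s g : {perm T}) (X : {set {perm T}}) (u v p q w : T).

(** * Counting transitions of points and of pairs *)

Definition point_count X u p := #|[set x in X | x u == p]|.
Definition pair_count X u v p q :=
  #|[set x in X | (x u == p) && (x v == q)]|.
Definition fixed_points x := #|[set u | x u == u]|.
(** The points lying on a 2-cycle of x. *)
Definition swapped_points x := #|[set u | (x u != u) && (x (x u) == u)]|.

Definition conj_closed X := forall x s, ((x ^ s)%g \in X) = (x \in X).
Definition uniform_on_pairs r X :=
  forall u v p q, u != v -> p != q -> pair_count X u v p q = r.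

Lemma card_set_sum (I : finType) (A : {pred I}) (P : pred I) :
  #|[set i in A | P i]| = \sum_(i in A) (P i : nat).
Proof.
rewrite -sum1dep_card big_mkcondr; apply: eq_bigr => i _; by case: (P i).
Qed.

Lemma sum_neq_const (w : T) (c : nat) : \sum_(v | v != w) c = #|T|.-1 * c.
Proof. by rewrite sum_nat_const (cardC1 w). Qed.

(** A permutation that sends u to p sends v to exactly one point, and by
    injectivity not to p. *)
Lemma sum_pair_count X u v p :
  u != v -> \sum_(q | q != p) pair_count X u v p q = point_count X u p.
Proof.
move=> uv; rewrite /point_count card_set_sum.
under eq_bigr do rewrite /pair_count card_set_sum.
rewrite exchange_big; apply: eq_bigr => x _.
have [xup|xup] := eqVneq (x u) p; last by rewrite big1.
rewrite (bigD1 (x v)) /=; last by rewrite -xup (inj_eq perm_inj) eq_sym.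
by rewrite eqxx big1 // => q /andP[_]; rewrite eq_sym => /negbTE ->.
Qed.

Lemma sum_point_count X u : \sum_p point_count X u p = #|X|.
Proof.
under eq_bigr do rewrite /point_count card_set_sum.
rewrite exchange_big -sum1_card; apply: eq_bigr => x _.
rewrite (bigD1 (x u)) //= eqxx big1 // => p.
by rewrite eq_sym => /negbTE ->.
Qed.

Lemma sum_point_count_fixed X :
  \sum_u point_count X u u = \sum_(x in X) fixed_points x.
Proof.
under eq_bigr do rewrite /point_count card_set_sum.
rewrite exchange_big; apply: eq_bigr => x _.
by rewrite -(card_set_sum predT).
Qed.

Lemma sum_pair_count_fixed X :
  \sum_u \sum_(v | v != u) pair_count X u v u v =
  \sum_(x in X) fixed_points x * (fixed_points x).-1.
Proof.
transitivity (\sum_u \sum_(x in X) \sum_(v | v != u)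
                ((x u == u) && (x v == v) : nat)).
  apply: eq_bigr => u _; rewrite exchange_big; apply: eq_bigr => v _.
  by rewrite /pair_count card_set_sum.
rewrite exchange_big; apply: eq_bigr => x _.
rewrite -sum_nat_const [RHS]big_mkcond; apply: eq_bigr => u _.
rewrite inE; have [xu|xu] := eqVneq (x u) u; last by rewrite big1.
rewrite /fixed_points (cardsD1 u) inE xu eqxx /= -card_set_sum.
by apply: eq_card => v; rewrite !inE.
Qed.

Lemma sum_pair_count_swapped X :
  \sum_u \sum_(v | v != u) pair_count X u v v u =
  \sum_(x in X) swapped_points x.
Proof.
transitivity (\sum_u \sum_(x in X) \sum_(v | v != u)
                ((x u == v) && (x v == u) : nat)).
  apply: eq_bigr => u _; rewrite exchange_big; apply: eq_bigr => v _.
  by rewrite /pair_count card_set_sum.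
rewrite exchange_big; apply: eq_bigr => x _.
rewrite /swapped_points (card_set_sum predT); apply: eq_bigr => u _.
have [xu|xu] := eqVneq (x u) u.
  by apply: big1 => v vu; rewrite xu eq_sym (negbTE vu).
rewrite (bigD1 (x u)) //= eqxx /= big1 ?addn0 // => v /andP[_].
by rewrite eq_sym => /negbTE ->.
Qed.

Lemma pair_countC X u v p q : pair_count X u v p q = pair_count X v u q p.
Proof. by apply: eq_card => x; rewrite !inE [(x u == p) && _]andbC. Qed.

Lemma pair_count_perm X s u v p q :
  conj_closed X -> pair_count X (s u) (s v) (s p) (s q) = pair_count X u v p q.
Proof.
move=> cX; rewrite -[RHS](card_imset _ (@conjg_inj _ s)); apply: eq_card => x.
rewrite -[x](conjgKV s) (mem_imset _ _ (@conjg_inj _ s)) !inE cX !permJ.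
by rewrite !(inj_eq perm_inj).
Qed.

Lemma point_count_perm X s u p :
  conj_closed X -> point_count X (s u) (s p) = point_count X u p.
Proof.
move=> cX; have pE w z : point_count X w z = pair_count X w w z z.
  by apply: eq_card => x; rewrite !inE andbb.
by rewrite !pE pair_count_perm.
Qed.

(** The symmetric group is 2-transitive; together with [pair_count_perm], this
    makes counts depend only on the coincidences among their arguments. *)
Lemma perm_pair u v p q :
  u != v -> p != q -> exists s : {perm T}, s u = p /\ s v = q.
Proof.
move=> uv pq; exists (tperm u p * tperm (tperm u p v) q)%g.
rewrite !permM tpermL; split; last by rewrite tpermL.
by rewrite tpermD // 1?eq_sym // -[X in X != _](tpermL u p) (inj_eq perm_inj).
Qed.

(** * Uniformity on pairs and its moments *)

(** Every pair of distinct points contributes r to each of the last two sums.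
    As (u, v) has #|T|.-1 images (u, q), every point u contributes #|T|.-1 * r
    to the first sum; the total number of pairs (p, q) gives #|X|. *)
Lemma uniform_moments r X :
  1 < #|T| -> uniform_on_pairs r X ->
  [/\ \sum_(x in X) fixed_points x = #|X|,
      \sum_(x in X) fixed_points x * (fixed_points x).-1 = #|X|
    & \sum_(x in X) swapped_points x = #|X|].
Proof.
move=> T_gt1 uni; have T1_gt0 : 0 < #|T|.-1 by lia.
have pointE u p : point_count X u p = #|T|.-1 * r.
  have /card_gt0P[v vu] : 0 < #|predC1 u| by rewrite cardC1.
  rewrite -(@sum_pair_count X u v) 1?eq_sym // -(sum_neq_const p).
  by apply: eq_bigr => q qp; rewrite uni // eq_sym.
have cardX : #|X| = #|T| * (#|T|.-1 * r).
  have [u _] : exists u, u \in T by apply/card_gt0P; exact: ltnW.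
  rewrite -(sum_point_count X u); under eq_bigr do rewrite pointE.
  by rewrite sum_nat_const.
rewrite cardX -sum_point_count_fixed -sum_pair_count_fixed.
rewrite -sum_pair_count_swapped -!sum_nat_const; split.
- by apply: eq_bigr => u _; rewrite pointE.
- apply: eq_bigr => u _; rewrite -(sum_neq_const u).
  by apply: eq_bigr => v vu; rewrite uni // eq_sym.
- apply: eq_bigr => u _; rewrite -(sum_neq_const u).
  by apply: eq_bigr => v vu; rewrite uni // eq_sym.
Qed.

(** The elimination step behind all the unknown counts: once the terms known to
    equal r are cancelled from a sum with mean r, the remaining terms are equal
    to each other and still have mean r. *)
Lemma sum_const_off (P B : pred T) (F : T -> nat) (r : nat) w :
  \sum_(z | P z) F z = \sum_(z | P z) r ->
  (forall z, P z -> B z -> F z = r) ->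
  (forall z, P z -> ~~ B z -> F z = F w) ->
  P w -> ~~ B w -> F w = r.
Proof.
move=> sumF FB FnB Pw Bw.
move: sumF; rewrite (bigID B) [RHS](bigID B) /=.
rewrite (eq_bigr (fun=> r)) => [|z /andP[/FB + Bz]]; last exact.
move/addnI; rewrite (eq_bigr (fun=> F w)) => [|z /andP[/FnB + Bz]]; last exact.
rewrite !sum_nat_const => /eqP; rewrite eqn_pmul2l => [/eqP //|].
by apply/card_gt0P; exists w; rewrite unfold_in Pw.
Qed.

(** For fixed u, v and p, the points q outside {u, v, p} are exchanged by
    transpositions that fix u, v and p, so they all have the same count; as the
    sum over q is the number of x sending u to p, the counts at q = u and q = v
    determine it. *)
Lemma pair_count_extend r X u v p q :
  conj_closed X -> u != v -> point_count X u p = #|T|.-1 * r ->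
  (u != p -> pair_count X u v p u = r) ->
  (v != p -> pair_count X u v p v = r) ->
  q != p -> q != u -> q != v -> pair_count X u v p q = r.
Proof.
move=> cX uv pt ru rv qp qu qv.
apply: (@sum_const_off (fun q => q != p) (pred2 u v) (pair_count X u v p)).
- by rewrite sum_pair_count // sum_neq_const.
- by move=> z zp /pred2P[] zE; subst z; auto.
- move=> z zp /norP[zu zv].
  rewrite -(@pair_count_perm X (tperm z q) u v p z cX).
  by rewrite tpermL !tpermD // 1?eq_sym.
- by [].
- by rewrite /= negb_or qu.
Qed.

(** The moments determine the counts for (u, v) -> (u, v) and (u, v) -> (v, u)
    and the counts for single points; [pair_count_extend] then gives the images
    (u, q) and (v, q), and finally those where u, v, p and q are distinct. *)
Lemma moments_uniform X :
  conj_closed X -> 1 < #|T| -> 0 < #|X| ->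
  \sum_(x in X) fixed_points x = #|X| ->
  \sum_(x in X) fixed_points x * (fixed_points x).-1 = #|X| ->
  \sum_(x in X) swapped_points x = #|X| ->
  exists2 r, 0 < r & uniform_on_pairs r X.
Proof.
move=> cX T_gt1 X_gt0.
rewrite -sum_point_count_fixed -sum_pair_count_fixed -sum_pair_count_swapped.
move=> fixS fix2S swapS.
have [u0 [v0 uv0]] : exists u0 v0 : T, u0 != v0.
  by move/card_gt1P: T_gt1 => [u0 [v0 [_ _ ?]]]; exists u0, v0.
pose r := pair_count X u0 v0 u0 v0.
have avg (F : T -> T -> nat) c : (forall u v, u != v -> F u v = c) ->
    \sum_u \sum_(v | v != u) F u v = #|T| * (#|T|.-1 * c).
  move=> FE; rewrite -sum_nat_const; apply: eq_bigr => u _.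
  rewrite -(sum_neq_const u); apply: eq_bigr => v vu.
  by rewrite FE // eq_sym.
have fixE u v : u != v -> pair_count X u v u v = r.
  by move=> uv; have [s [<- <-]] := perm_pair uv0 uv; rewrite pair_count_perm.
have cardX : #|X| = #|T| * (#|T|.-1 * r) by rewrite -fix2S (avg _ _ fixE).
have swapE u v : u != v -> pair_count X u v v u = r.
  have swE w z : w != z -> pair_count X w z z w = pair_count X u0 v0 v0 u0.
    by move=> wz; have [s [<- <-]] := perm_pair uv0 wz; rewrite pair_count_perm.
  move=> uv; apply/eqP; rewrite swE //.
  have := swapS; rewrite (avg _ _ swE) cardX => /eqP.
  by rewrite !eqn_pmul2l //; lia.
have ptfixE u : point_count X u u = #|T|.-1 * r.
  apply/eqP; rewrite -(@eqn_pmul2l #|T|); last by lia.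
  rewrite -cardX -fixS -sum_nat_const; apply/eqP; apply: eq_bigr => w _.
  by rewrite -(@point_count_perm X (tperm u w)) // tpermL.
have ptE u p : point_count X u p = #|T|.-1 * r.
  have [->//|pu] := eqVneq p u.
  apply: (@sum_const_off predT (pred1 u) (point_count X u)) => //.
  - by rewrite sum_point_count sum_nat_const.
  - by move=> z _ /eqP ->.
  - move=> z _ /= zu; rewrite -(@point_count_perm X (tperm z p)) //.
    by rewrite tpermL tpermD // eq_sym.
exists r; first by move: X_gt0; rewrite cardX !muln_gt0 => /and3P[].
have fix1E u v q : u != v -> u != q -> pair_count X u v u q = r.
  move=> uv uq; have [->|qv] := eqVneq q v; first exact: fixE.
  apply: pair_count_extend => //; rewrite ?eqxx // 1?eq_sym //.
  by move=> _; exact: fixE.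
have pathE u v q : u != v -> v != q -> pair_count X u v v q = r.
  move=> uv vq; have [->|qu] := eqVneq q u; first exact: swapE.
  apply: pair_count_extend => //; rewrite ?eqxx // 1?eq_sym //.
  by move=> _; exact: swapE.
move=> u v p q uv pq.
have [qu|qu] := eqVneq q u.
  by subst q; rewrite pair_countC pathE // 1?eq_sym.
have [qv|qv] := eqVneq q v.
  by subst q; rewrite pair_countC fix1E // 1?eq_sym.
apply: pair_count_extend => // [up|vp|]; last by rewrite eq_sym.
  by rewrite pair_countC pathE // 1?eq_sym.
by rewrite pair_countC fix1E // 1?eq_sym.
Qed.

(** * Fixed points and 2-cycles on conjugacy classes *)

Lemma fixed_points_conj x s : fixed_points (x ^ s)%g = fixed_points x.
Proof.
rewrite -[RHS](card_imset _ (@perm_inj _ s)); apply: eq_card => u.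
rewrite -[u](permKV s) (mem_imset _ _ (@perm_inj _ s)) !inE permJ.
by rewrite (inj_eq perm_inj).
Qed.

Lemma swapped_points_conj x s : swapped_points (x ^ s)%g = swapped_points x.
Proof.
rewrite -[RHS](card_imset _ (@perm_inj _ s)); apply: eq_card => u.
rewrite -[u](permKV s) (mem_imset _ _ (@perm_inj _ s)) !inE !permJ.
by rewrite !(inj_eq perm_inj).
Qed.

Lemma card_porbit2 x u :
  (#|porbit x u| == 2) = (x u != u) && (x (x u) == u).
Proof.
have ux : u \in porbit x u := porbit_id x u.
have xux : x u \in porbit x u by have := mem_porbit x 1 u; rewrite expg1.
apply/idP/andP => [/eqP c2|[xu /eqP xxu]].
  have := uniq_traject_porbit x u; have := iter_porbit x u.
  by rewrite c2 /= inE eq_sym andbT => -> ->.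
suff -> : porbit x u = [set u; x u] by rewrite cards2 [u == _]eq_sym xu.
apply/setP => w; rewrite !inE; apply/idP/orP => [|[]/eqP-> //].
case/porbitP => i ->; elim: i => [|i [/eqP IH|/eqP IH]].
- by rewrite expg0 perm1 eqxx; left.
- by rewrite expgSr permM IH eqxx; right.
- by rewrite expgSr permM IH xxu eqxx; left.
Qed.

Lemma swapped_points_porbits x :
  swapped_points x = #|[set c in porbits x | #|c| == 2]| * 2.
Proof.
have mem_porbit_eq c u :
    c \in porbits x -> (porbit x u == c) = (u \in c).
  by case/imsetP => w _ ->; rewrite eq_porbit_mem.
rewrite /swapped_points -sum1dep_card.
rewrite (partition_big (porbit x)
  (fun c => c \in [set c in porbits x | #|c| == 2])) /=; last first.
  by move=> u; rewrite -card_porbit2 inE imset_f.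
rewrite -sum_nat_const; apply: eq_bigr => c.
rewrite inE => /andP[cx /eqP c2]; rewrite -[RHS]c2 -sum1_card.
apply: eq_bigl => u; rewrite mem_porbit_eq // -card_porbit2 andbC.
have [uc|//] := boolP (u \in c).
by move: uc; rewrite -mem_porbit_eq // => /eqP ->; rewrite c2.
Qed.

Lemma sum_conj_classes (F : {perm T} -> nat) (X1 X2 : {set {perm T}}) x1 x2 :
  (forall x s, F (x ^ s)%g = F x) ->
  X1 \in classes [set: {perm T}] -> X2 \in classes [set: {perm T}] ->
  X1 <> X2 -> x1 \in X1 -> x2 \in X2 ->
  \sum_(x in X1 :|: X2) F x = #|X1| * F x1 + #|X2| * F x2.
Proof.
move=> FJ cX1 cX2 X12 x1X1 x2X2.
have classE C c : C \in classes [set: {perm T}] -> c \in C ->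
    C = (c ^: [set: {perm T}])%g.
  by case/imsetP => y _ -> cy; apply/esym/class_eqP.
have sumE C c : C \in classes [set: {perm T}] -> c \in C ->
    \sum_(x in C) F x = #|C| * F c.
  move=> /classE CE cC; rewrite -sum_nat_const; apply: eq_bigr => x.
  by rewrite (CE c cC) => /imsetP[s _ ->]; rewrite FJ.
rewrite -(sumE X1 x1) // -(sumE X2 x2) // -bigU /=.
  by apply: eq_bigl => x; rewrite !inE.
apply/pred0P => x /=; apply/negbTE/negP => /andP[xX1 xX2].
by apply: X12; rewrite (classE X1 x) // (classE X2 x).
Qed.

Lemma classes_conj_closed (X : {set {perm T}}) :
  X \in classes [set: {perm T}] -> conj_closed X.
Proof.
case/imsetP => y _ -> x s.
by apply/class_eqP/class_eqP; rewrite classGidl ?inE.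
Qed.

End Counting.

(** * The Young subgroup of type (n - 2, 1, 1) *)

Lemma Young_subgroupP n (p q : 'I_n) (s : 'S_n) :
  3 <= n -> p = n - 2 :> nat -> q = n - 1 :> nat ->
  (s \in Young_subgroup n [:: n - 2; 1; 1]) = (s p == p) && (s q == q).
Proof.
move=> n_ge3 pE qE.
have pq : p != q by rewrite -val_eqE /= pE qE; lia.
have blockE (i : 'I_n) : reshape_index [:: n - 2; 1; 1] i =
    if i == q then 2 else if i == p then 1 else 0.
  rewrite -!val_eqE /= pE qE /reshape_index /=.
  have i_n := ltn_ord i.
  by do !case: eqP; lia.
rewrite inE; apply/forallP/andP => [block|[sp sq] i].
  have := block p; have := block q; rewrite !blockE !eqxx (negbTE pq).
  by do 4![case: ifP => //].
by rewrite !blockE -{1}(eqP sq) -{1}(eqP sp) !(inj_eq perm_inj).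
Qed.

(** For g = a b with b = a^-1 g, the element b fixes p and q exactly when a
    sends u = g^-1 p to p and v = g^-1 q to q.  So the pairs counted at g
    correspond to the elements of X sending (u, v) to (p, q), and every pair of
    distinct points arises as (u, v) for some g. *)
Lemma mult_factorization_Young n r (X : {set 'S_n}) (p q : 'I_n) :
  3 <= n -> p = n - 2 :> nat -> q = n - 1 :> nat -> conj_closed X ->
  mult_factorization r X (Young_subgroup n [:: n - 2; 1; 1]) <->
  uniform_on_pairs r X.
Proof.
move=> n_ge3 pE qE cX.
have pq : p != q by rewrite -val_eqE /= pE qE; lia.
have countE (g : 'S_n) u v : g u = p -> g v = q ->
    #|[set ab : 'S_n * 'S_n | [&& ab.1 \in X,
         ab.2 \in Young_subgroup n [:: n - 2; 1; 1] & (ab.1 * ab.2)%g == g]]|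
    = pair_count X u v p q.
  move=> gu gv.
  have inj : injective (fun a : 'S_n => (a, a^-1 * g)%g) by move=> a b [].
  have fixE a w z : g w = z -> ((a^-1 * g)%g z == z) = (a w == z).
    move=> <-; rewrite permM (inj_eq perm_inj).
    by rewrite (can2_eq (permKV a) (permK a)) eq_sym.
  have YE a : ((a^-1 * g)%g \in Young_subgroup n [:: n - 2; 1; 1]) =
      (a u == p) && (a v == q).
    by rewrite (Young_subgroupP _ n_ge3 pE qE) !(fixE a _ _ gu, fixE a _ _ gv).
  rewrite /pair_count -(card_imset _ inj); apply: eq_card => -[a b].
  rewrite inE /=; apply/and3P/imsetP => [[aX bY /eqP abg]|[c cP [-> ->]]].
    have bE : b = (a^-1 * g)%g by rewrite -abg mulKg.
    by exists a; rewrite ?bE // inE aX -YE -bE.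
  by move: cP; rewrite inE -YE => /andP[cX' cY]; split=> //; rewrite mulKVg.
split=> [fact u v p' q' uv pq'|uni g].
  (* Renaming the points by the inverse of s moves (p', q') back to (p, q). *)
  have [s [<- <-]] := perm_pair pq pq'.
  rewrite -[u](permKV s) -[v](permKV s) pair_count_perm //.
  have [|g [gu gv]] := @perm_pair _ ((s^-1)%g u) ((s^-1)%g v) p q _ pq.
    by rewrite (inj_eq perm_inj).
  by rewrite -(countE g).
rewrite (countE g (g^-1 p)%g (g^-1 q)%g) ?permKV //.
by rewrite uni // (inj_eq perm_inj).
Qed.

(** * Two conjugacy classes *)

(** If f1 and f2 were both positive, then, having weighted mean 1, they would
    both be 1, and the second sum would be 0. *)
Lemma two_class_moments m1 m2 f1 f2 t1 t2 :
  0 < m1 -> 0 < m2 ->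
  [/\ m1 * f1 + m2 * f2 = m1 + m2,
      m1 * (f1 * f1.-1) + m2 * (f2 * f2.-1) = m1 + m2
    & m1 * (t1 * 2) + m2 * (t2 * 2) = m1 + m2]
  <->
  ([/\ f1 = 0, f2 = 2, m1 = m2 & t1 + t2 = 1] \/
   [/\ f2 = 0, f1 = 2, m2 = m1 & t2 + t1 = 1]).
Proof.
move=> m1_gt0 m2_gt0; split; last first.
  by case=> -[-> -> <- t12]; split; nia.
(* The case where one class, of size a, has no fixed points: the first two
   equations then give g (g - 1) = g. *)
have zero_two a b s t g : 0 < a -> 0 < b -> b * g = a + b ->
    b * (g * g.-1) = a + b -> a * (s * 2) + b * (t * 2) = a + b ->
    [/\ g = 2, a = b & s + t = 1].
  move=> a_gt0 b_gt0 e1 e2 e3.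
  have g2 : g = 2.
    have : g * g.-1 = g * 1 by apply/eqP; rewrite -(eqn_pmul2l b_gt0); lia.
    by case: g e1 e2 => [|[|[|g]]]; nia.
  have ab : a = b by lia.
  by split=> //; apply/eqP; rewrite -(eqn_pmul2l b_gt0); nia.
case; case: f1 => [|f1]; first rewrite !muln0 !add0n => e1 e2 e3.
  by left; have [-> -> ->] := zero_two _ _ _ _ _ m1_gt0 m2_gt0 e1 e2 e3.
case: f2 => [|f2] e1 e2 e3.
  right.
  by have [|||-> -> ->] := zero_two m2 m1 t2 t1 f1.+1 m2_gt0 m1_gt0 => //; lia.
have f1E : f1 = 0 by nia.
have f2E : f2 = 0 by nia.
by subst; lia.
Qed.

Theorem theorem3p6 (n : nat) (X1 X2 : {set 'S_n}) (x1 x2 : 'S_n)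
    (n_ge3 : 3 <= n)
    (X1_class : X1 \in classes [set: 'S_n])
    (X2_class : X2 \in classes [set: 'S_n])
    (X1_neq_X2 : X1 <> X2)
    (x1_in : x1 \in X1) (x2_in : x2 \in X2) :
  (exists r : nat,
     0 < r /\
     mult_factorization r (X1 :|: X2) (Young_subgroup n [:: n - 2; 1; 1]))
  <->
  ([/\ num_fixed_points x1 = 0, num_fixed_points x2 = 2, #|X1| = #|X2|
     & num_cycles 2 x1 + num_cycles 2 x2 = 1]
   \/
   [/\ num_fixed_points x2 = 0, num_fixed_points x1 = 2, #|X2| = #|X1|
     & num_cycles 2 x2 + num_cycles 2 x1 = 1]).
Proof.
have n2 : n - 2 < n by lia.
have n1 : n - 1 < n by lia.
have cX : conj_closed (X1 :|: X2).
  by move=> x s; rewrite !inE !classes_conj_closed.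
have factP r := @mult_factorization_Young n r _ (Ordinal n2) (Ordinal n1)
  n_ge3 erefl erefl cX.
have T_gt1 : 1 < #|'I_n| by rewrite card_ord; lia.
have X1_gt0 : 0 < #|X1| by apply/card_gt0P; exists x1.
have X2_gt0 : 0 < #|X2| by apply/card_gt0P; exists x2.
have sumE F (FJ : forall x s, F (x ^ s)%g = F x) :=
  sum_conj_classes FJ X1_class X2_class X1_neq_X2 x1_in x2_in.
have cardE : #|X1 :|: X2| = #|X1| + #|X2|.
  by rewrite -sum1_card (sumE (fun=> 1)) // !muln1.
have fixE := sumE _ (@fixed_points_conj _).
have fix2E := sumE (fun x => fixed_points x * (fixed_points x).-1)
  (fun x s => congr1 (fun f => f * f.-1) (fixed_points_conj x s)).
have swapE := sumE _ (@swapped_points_conj _).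
rewrite !swapped_points_porbits in swapE.
apply: iff_trans (two_class_moments _ _ _ _ X1_gt0 X2_gt0).
rewrite -[num_fixed_points x1]/(fixed_points x1).
rewrite -[num_fixed_points x2]/(fixed_points x2).
rewrite -fixE -fix2E -swapE -cardE; split=> [[r [_ /factP]]|[m1 m2 m3]].
  exact: uniform_moments.
have [|r r_gt0 uni] := moments_uniform cX T_gt1 _ m1 m2 m3.
  by rewrite cardE addn_gt0 X1_gt0.
by exists r; split=> //; apply/factP.
Qed.
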